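(* There is an instance $({\sf K},p)$ of the two-way-comparison search tree problem such that, on this instance, Spuler's algorithm (described in the context) computes, for some subproblem $(I,h)$ of its dynamic program, a tree $t^*(I,h)$ that is not of minimum cost among all trees for $(I,H)$ with $H\subseteq I$, $|H|=h$. In particular, Spuler's recurrence is incorrect for some subproblems.
   Context: An instance $({\sf K},p)$ consists of keys ${\sf K}=\{1,\dots,n\}$ with non-negative weights $p_k$. A two-way-comparison search tree for a query set $S\subseteq{\sf K}$ is a rooted binary tree in which each internal node has two children and is labeled by a key $k\in{\sf K}$ and an operator, either equality ($v=k$?) or less-than ($v<k$?); it has $|S|$ leaves, each labeled by a distinct element of $S$. The search for a query $v$ starts at the root and at each internal node follows the ''yes'' or ''no'' child according to the outcome of the comparison; the tree is correct if for every $v\in S$ the search ends at the leaf labeled $v$. Its cost is $\sum_{v\in S}p_v\cdot\mathrm{depth}(v)$, and its weight is $\sum_{v\in S}p_v$. For an interval $I=[i,j]=\{i,\dots,j\}$ and integer $h$, a subproblem $(I,h)$ asks for a minimum-cost correct tree for query set $I\setminus H$ over all $H\subseteq I$ with $|H|=h$. Spuler's algorithm computes for each subproblem $(I,h)$, $I=[i,j]$, a tree $t^*(I,h)$ with cost $c(I,h)$. If $|I|-h=1$ the tree is a single leaf (cost $0$). If $|I|-h>1$: (1) an equality candidate is formed: let $e$ be a least-weight key of $I$ that is not a leaf of $t^*(I,h+1)$; the candidate has root ''$v=e$?'' with yes-child the leaf $e$ and no-subtree $t^*(I,h+1)$; (2) for every $s\in I$ and $h_1,h_2\ge 0$ with $h_1+h_2=h$,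 $s-i-h_1\ge1$ and $j-s+1-h_2\ge1$, a less-than candidate is formed with root ''$v<s$?'' and subtrees $t^*([i,s-1],h_1)$ and $t^*([s,j],h_2)$; (3) $t^*(I,h)$ is a minimum-cost candidate, where a candidate's cost is its weight plus the costs of its two subtrees. The final answer is $t^*({\sf K},0)$. *)

(* Defs.v *)
(* Keys are the natural numbers 1, ..., n. *)
From mathcomp Require Export all_boot all_order all_algebra finmap.

Set Implicit Arguments.
Unset Strict Implicit.
Unset Printing Implicit Defensive.

Import Order.TTheory GRing.Theory Num.Theory.
Local Open Scope fset_scope.
Local Open Scope ring_scope.

Inductive operator := Equal | Less.

(* [Node o k yes no] *)
Inductive tree :=
| Leaf of nat
| Node of operator & nat & tree & tree.

Definition outcome (o : operator) (k v : nat) : bool :=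
  match o with Equal => v == k | Less => (v < k)%N end.

Fixpoint leaves (t : tree) : seq nat :=
  match t with
  | Leaf k => [:: k]
  | Node _ _ yes no => leaves yes ++ leaves no
  end.

Fixpoint node_keys (t : tree) : seq nat :=
  match t with
  | Leaf _ => [::]
  | Node _ k yes no => k :: node_keys yes ++ node_keys no
  end.

(* The label of the leaf at which the search for [v] ends. *)
Fixpoint search (t : tree) (v : nat) : nat :=
  match t with
  | Leaf k => k
  | Node o k yes no => if outcome o k v then search yes v else search no v
  end.

(* The depth of the leaf labeled [v]; junk if there is none. *)
Fixpoint depth (t : tree) (v : nat) : nat :=
  match t with
  | Leaf _ => 0%N
  | Node _ _ yes no => (if v \in leaves yes then depth yes v else depth no v).+1
  end.

Definition weight (R : realFieldType) (p : nat -> R) (t : tree) : R :=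
  \sum_(v <- leaves t) p v.

Definition cost (R : realFieldType) (p : nat -> R) (t : tree) : R :=
  \sum_(v <- leaves t) p v * (depth t v)%:R.

Definition itv (i j : nat) : {fset nat} := [fset k in iota i (j.+1 - i)].

(* [t] is a correct tree for the query set [S] over the keys 1, ..., n. *)
Definition correct_tree (n : nat) (S : {fset nat}) (t : tree) : Prop :=
  [/\ {in node_keys t, forall k, k \in itv 1 n},
      uniq (leaves t),
      leaves t =i S &
      {in S, forall v, search t v = v}].

Definition subproblem (n i j h : nat) : Prop :=
  [/\ (1 <= i)%N, (i <= j)%N, (j <= n)%N & (1 <= #|` itv i j| - h)%N].

Definition tree_for (n i j h : nat) (t : tree) : Prop :=
  exists H : {fset nat},
    [/\ H `<=` itv i j, #|` H| = h & correct_tree n (itv i j `\` H) t].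

Definition min_cost_tree (R : realFieldType) (p : nat -> R) (n i j h : nat)
    (t : tree) : Prop :=
  tree_for n i j h t /\
  forall t', tree_for n i j h t' -> cost p t <= cost p t'.

(* A table [T] gives the tree [T i j h] computed for the interval [i, j] and
   the number h of holes.  When several keys [e] tie for least weight, the
   resulting candidates all have the same cost. *)
Inductive candidate (R : realFieldType) (p : nat -> R)
    (T : nat -> nat -> nat -> tree) (i j h : nat) : tree -> Prop :=
| EqualityCandidate e :
    e \in itv i j -> e \notin leaves (T i j h.+1) ->
    (forall k, k \in itv i j -> k \notin leaves (T i j h.+1) -> p e <= p k) ->
    candidate p T i j h (Node Equal e (Leaf e) (T i j h.+1))
| LessCandidate s h1 h2 :
    s \in itv i j -> (h1 + h2 = h)%N ->
    (1 <= s - i - h1)%N -> (1 <= j - s + 1 - h2)%N ->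
    candidate p T i j h (Node Less s (T i s.-1 h1) (T s j h2)).

Definition candidate_cost (R : realFieldType) (p : nat -> R) (t : tree) : R :=
  match t with
  | Leaf _ => 0
  | Node _ _ yes no => weight p t + cost p yes + cost p no
  end.

(* The algorithm leaves open which key labels a single-leaf tree and how ties
   are broken: a run is any table obtained by resolving these choices.  Entries
   of [T] outside the subproblems are unconstrained. *)
Definition spuler_run (R : realFieldType) (n : nat) (p : nat -> R)
    (T : nat -> nat -> nat -> tree) : Prop :=
  forall i j h, subproblem n i j h ->
    ((#|` itv i j| - h = 1)%N -> exists2 k, k \in itv i j & T i j h = Leaf k) /\
    ((1 < #|` itv i j| - h)%N ->
       candidate p T i j h (T i j h) /\
       forall c, candidate p T i j h c ->
         candidate_cost p (T i j h) <= candidate_cost p c).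

(* Main.v *)
(** On the weights 12, 10, 4, 10, 10, 1, 11, 11 the tree for 7 of the 8 keys has
    minimum cost 159, reached only by splitting {2,3,4,5,6} from {7,8} with
    "v < 7?".  Its left part costs 80, but with one hole in [1,6] the heavier
    set {1,2,3,4,6} costs only 79.  Spuler's table must store a tree of cost at
    most 79 for ([1,6], 1), or fail there; the weight it does not account for
    then makes the combined candidate for ([1,8], 1) cost at least 160.

    Lower bounds on costs come from any function [f] on key sets that is 0 on
    singletons and satisfies f(S) <= weight(S) + f(S1) + f(S2) whenever one
    comparison divides S into S1 and S2. *)
Require Import Defs.
From mathcomp Require Import all_boot all_order all_algebra finmap.
From mathcomp Require Import zify lra.

Import Order.TTheory GRing.Theory Num.Theory.
Local Open Scope ring_scope.

(** * Correct trees taken apart and assembled at the root *)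

Lemma in_itv i j k : (k \in itv i j) = (i <= k <= j)%N.
Proof. by rewrite /itv in_fset /= mem_iota; lia. Qed.

Lemma card_itv i j : #|` itv i j|%fset = (j.+1 - i)%N.
Proof.
by rewrite /itv card_fseq undup_id ?iota_uniq // size_iota.
Qed.

Lemma search_leaves t v : search t v \in leaves t.
Proof.
elim: t => [k|o k y IHy z IHz] /=; first by rewrite inE.
by rewrite mem_cat; case: ifP; rewrite ?IHy ?IHz ?orbT.
Qed.

(** The two subtrees have disjoint leaves, and every search ends at a leaf of the subtree it enters.
    Hence a key of [S] whose leaf is in [y] must answer yes, and one whose leaf is in [z] must
    answer no, so the root comparison determines both query sets. *)
Lemma correct_tree_node n S o k y z :
  correct_tree n S (Node o k y z) ->
  [/\ k \in itv 1 n,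
      correct_tree n [fset v in S | outcome o k v]%fset y &
      correct_tree n [fset v in S | ~~ outcome o k v]%fset z].
Proof.
case=> /= keysP; rewrite cat_uniq => /and3P[uy /hasPn dis uz] leavesP searchP.
have yP v : v \in leaves y -> outcome o k v.
  move=> vy; have vS : v \in S by rewrite -leavesP mem_cat vy.
  apply: contraLR (vy) => /negbTE ov.
  by move: (searchP v vS); rewrite ov => <-; apply/dis/search_leaves.
have zP v : v \in leaves z -> ~~ outcome o k v.
  move=> vz; have vS : v \in S by rewrite -leavesP mem_cat vz orbT.
  apply/negP => ov; move: (dis v vz); move: (searchP v vS).
  by rewrite ov => sv /negP; apply; rewrite -sv; apply: search_leaves.
split.
- by apply: keysP; rewrite inE eqxx.
- split=> //.
  + by move=> l ly; apply: keysP; rewrite inE mem_cat ly orbT.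
  + move=> v; rewrite !inE /= -leavesP mem_cat.
    apply/idP/andP => [vy|[/orP[//|/zP/negP] ov]]; first by rewrite vy yP.
    by move/ov.
  + by move=> v; rewrite !inE /= => /andP[vS ov]; move: (searchP v vS); rewrite ov.
- split=> //.
  + by move=> l lz; apply: keysP; rewrite inE mem_cat lz !orbT.
  + move=> v; rewrite !inE /= -leavesP mem_cat.
    apply/idP/andP => [vz|[/orP[/yP ->//|//]]]; by rewrite vz orbT zP.
  + by move=> v; rewrite !inE /= => /andP[vS /negbTE ov]; move: (searchP v vS);
      rewrite ov.
Qed.

Lemma correct_tree_join n S1 S2 o k y z :
    k \in itv 1 n -> correct_tree n S1 y -> correct_tree n S2 z ->
    {in S1, forall v, outcome o k v} -> {in S2, forall v, ~~ outcome o k v} ->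
  correct_tree n (S1 `|` S2)%fset (Node o k y z).
Proof.
move=> kn [ky uy ly sy] [kz uz lz sz] o1 o2; split=> /=.
- by move=> l; rewrite inE mem_cat => /or3P[/eqP->|/ky|/kz].
- rewrite cat_uniq uy uz andbT; apply/hasPn => v; rewrite lz => /o2 ov.
  by apply/negP => /=; rewrite ly => /o1; apply/negP.
- by move=> v; rewrite mem_cat ly lz inE.
- move=> v; rewrite inE => /orP[vS|vS]; first by rewrite o1 ?sy.
  by rewrite (negbTE (o2 v vS)) sz.
Qed.

Lemma correct_tree_leaf n k : correct_tree n [fset k]%fset (Leaf k).
Proof.
by split=> // [v|v]; rewrite !inE // => /eqP->.
Qed.

Lemma size_leaves n S t : correct_tree n S t -> size (leaves t) = #|` S|%fset.
Proof.
case=> _ ut lt _; rewrite -(undup_id ut) -card_fseq; congr #|` _|%fset.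
by apply/fsetP => v; rewrite in_fset lt.
Qed.

(** Trades the hole set for its complement, the query set [S]. The bound on [h] makes the truncated
    subtraction exact, so that the complement of [S] has exactly [h] keys. *)
Lemma tree_forP n i j h t : (h <= j.+1 - i)%N ->
  tree_for n i j h t <->
  exists S : {fset nat}, [/\ {in S, forall v, (i <= v <= j)%N},
    #|` S|%fset = (j.+1 - i - h)%N & correct_tree n S t].
Proof.
move=> leh; split=> [[H [sub cardH ct]]|[S [sub cardS ct]]].
  exists (itv i j `\` H)%fset; split=> //.
    by move=> v; rewrite inE in_itv => /andP[].
  by rewrite cardfsDS // card_itv cardH.
have sub' : (S `<=` itv i j)%fset.
  by apply/fsubsetP => v /sub; rewrite in_itv.
exists (itv i j `\` S)%fset; split.
- exact: fsubsetDl.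
- by rewrite cardfsDS // card_itv cardS; lia.
- rewrite fsetDDr fsetDv fset0U; suff -> : (itv i j `&` S)%fset = S by [].
  exact/fsetIidPr.
Qed.

(** The conditions on a run are imposed only on subproblems with at most [m] leaves, so that a table
    can be built one size at a time. *)
Definition run_upto {R : realFieldType} (m n : nat) (p : nat -> R)
    (T : nat -> nat -> nat -> tree) : Prop :=
  forall i j h, subproblem n i j h -> (j.+1 - i - h <= m)%N ->
    ((j.+1 - i - h = 1)%N -> exists2 k, k \in itv i j & T i j h = Leaf k) /\
    ((1 < j.+1 - i - h)%N ->
       candidate p T i j h (T i j h) /\
       forall c, candidate p T i j h c ->
         candidate_cost p (T i j h) <= candidate_cost p c).

Lemma spuler_run_upto (R : realFieldType) (n : nat) (p : nat -> R) T :
  spuler_run n p T <-> run_upto n n p T.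
Proof.
split=> H i j h sub => [_|]; first by rewrite -card_itv; apply: H.
rewrite card_itv; apply: H => //.
by case: sub; lia.
Qed.

Lemma subproblemE n i j h : subproblem n i j h <->
  [/\ (1 <= i)%N, (j <= n)%N & (h < j.+1 - i)%N].
Proof.
rewrite /subproblem card_itv; split=> [[*]|[*]]; split=> //; lia.
Qed.

(** Induction on the number of leaves: each candidate is assembled from entries with fewer leaves.
    An equality root adds a key absent from the no-subtree, and a less-than root joins trees over
    disjoint intervals. Entries of a run can therefore fail only by not being optimal. *)
Lemma run_tree_for (R : realFieldType) m n (p : nat -> R) T i j h :
  run_upto m n p T -> subproblem n i j h -> (j.+1 - i - h <= m)%N ->
  tree_for n i j h (T i j h).
Proof.
move=> run; move: {2}(j.+1 - i - h)%N (leqnn (j.+1 - i - h)%N) => d.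
elim: d i j h => [|d IH] i j h led sub lem.
  by case/subproblemE: sub; lia.
have [i1 jn hlt] := (subproblemE _ _ _ _).1 sub.
apply/tree_forP; first lia.
have [leafP nodeP] := run i j h sub lem.
have [d1|d1] : (j.+1 - i - h = 1)%N \/ (1 < j.+1 - i - h)%N by lia.
  have [k kI ->] := leafP d1; exists [fset k]%fset; split.
  - by move=> v; rewrite inE => /eqP->; rewrite -in_itv.
  - by rewrite cardfs1.
  - exact: correct_tree_leaf.
have [] := nodeP d1; case=> [e eI eT _ _|s h1 h2 sI hE lo hi _].
  have sub' : subproblem n i j h.+1 by apply/subproblemE; split=> //; lia.
  have /tree_forP[|S [Ssub Scard Sct]] :=
    IH i j h.+1 ltac:(lia) sub' ltac:(lia); first lia.
  have eS : e \notin S by case: Sct => _ _ <-.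
  exists (e |` S)%fset; split.
  - by move=> v; rewrite !inE => /orP[/eqP->|/Ssub//]; rewrite -in_itv.
  - by rewrite cardfsU1 eS Scard; lia.
  - apply: correct_tree_join => //; last first.
    + by move=> v vS /=; apply: contraNneq eS => <-.
    + by move=> v; rewrite inE.
    + exact: correct_tree_leaf.
    + by move: eI; rewrite !in_itv; lia.
rewrite in_itv in sI.
have subL : subproblem n i s.-1 h1 by apply/subproblemE; split; lia.
have subR : subproblem n s j h2 by apply/subproblemE; split; lia.
have /tree_forP[|S1 [sub1 card1 ct1]] :=
  IH i s.-1 h1 ltac:(lia) subL ltac:(lia); first lia.
have /tree_forP[|S2 [sub2 card2 ct2]] :=
  IH s j h2 ltac:(lia) subR ltac:(lia); first lia.
exists (S1 `|` S2)%fset; split.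
- by move=> v; rewrite inE => /orP[/sub1|/sub2]; lia.
- rewrite cardfsU card1 card2; suff -> : (S1 `&` S2 = fset0)%fset.
    by rewrite cardfs0; lia.
  apply/fsetP => v; rewrite !inE; apply/negP => /andP[/sub1 ? /sub2 ?]; lia.
- apply: correct_tree_join => //.
  + by rewrite in_itv; lia.
  + by move=> v /sub1 /=; lia.
  + by move=> v /sub2 /=; lia.
Qed.

(** * Recursion for the cost, and locality of candidates *)

Lemma weight_node (R : realFieldType) (p : nat -> R) o k y z :
  weight p (Node o k y z) = weight p y + weight p z.
Proof. by rewrite /weight /= big_cat. Qed.

(** Since leaf labels are distinct, [depth] descends into the subtree holding the leaf. The root
    thus adds one to every depth, which contributes the weight of the tree. *)
Lemma cost_node (R : realFieldType) (p : nat -> R) o k y z :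
  uniq (leaves (Node o k y z)) ->
  cost p (Node o k y z) = weight p (Node o k y z) + cost p y + cost p z.
Proof.
rewrite /= cat_uniq => /and3P[_ /hasPn dis _].
rewrite weight_node /cost /weight /= big_cat /=.
rewrite [X in X + _ = _](_ : _ = weight p y + cost p y); last first.
  rewrite /weight /cost -big_split /= big_seq [RHS]big_seq.
  by apply: eq_bigr => v vy; rewrite vy -natr1 mulrDr mulr1 addrC.
rewrite [X in _ + X = _](_ : _ = weight p z + cost p z); last first.
  rewrite /weight /cost -big_split /= big_seq [RHS]big_seq.
  apply: eq_bigr => v vz; rewrite (negbTE (dis v vz)).
  by rewrite -natr1 mulrDr mulr1 addrC.
by rewrite /weight /cost; lra.
Qed.

(** A candidate reads only table entries with fewer leaves than its own subproblem. *)
Lemma candidate_congr (R : realFieldType) (p : nat -> R) T T' i j h c :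
    (0 < i)%N -> (1 < j.+1 - i - h)%N ->
    (forall i' j' h', (j'.+1 - i' - h' < j.+1 - i - h)%N ->
       T i' j' h' = T' i' j' h') ->
  candidate p T i j h c -> candidate p T' i j h c.
Proof.
move=> i0 d1 eqT; case=> [e eI eT emin|s h1 h2 sI hE lo hi].
  rewrite eqT in eT emin *; last lia.
  exact: EqualityCandidate.
have ? := sI; rewrite in_itv in sI.
by rewrite !eqT; [exact: LessCandidate | lia | lia].
Qed.

(** * Existence of a run *)

Section Argmin.
Variables (R : realFieldType) (A : eqType).

Definition argmin (x0 : A) (F : A -> R) (s : seq A) : A :=
  head x0 [seq x <- s | all (fun y => F x <= F y) s].

Lemma argminP (x0 : A) (F : A -> R) (s : seq A) : s != [::] ->
  argmin x0 F s \in s /\ {in s, forall y, F (argmin x0 F s) <= F y}.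
Proof.
move=> s0; have [x xs xmin] : exists2 x, x \in s & {in s, forall y, F x <= F y}.
  elim: s s0 => // a [|b s] IH _.
    by exists a => [|y]; rewrite inE // => /eqP->.
  have [//|x xs xmin] := IH.
  have [le|lt] := lerP (F a) (F x).
    exists a; first by rewrite inE eqxx.
    by move=> y; rewrite inE => /predU1P[->//|/xmin]; apply: le_trans.
  exists x; first by rewrite inE xs orbT.
  by move=> y; rewrite inE => /predU1P[->|/xmin//]; apply: ltW.
have : argmin x0 F s \in [seq x <- s | all (fun y => F x <= F y) s].
  rewrite /argmin; have : x \in [seq x <- s | all (fun y => F x <= F y) s].
    by rewrite mem_filter xs andbT; apply/allP.
  by case: [seq _ <- _ | _] => //= a l _; rewrite inE eqxx.
by rewrite mem_filter => /andP[/allP].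
Qed.

End Argmin.

Arguments argmin {R A}.

Section RunExists.
Variables (R : realFieldType) (n : nat) (p : nat -> R).

(* A candidate is encoded by its root: [inl e] for "v = e?" and
   [inr (s, h1)] for "v < s?" with h1 holes on the left. *)
Definition candidate_of (T : nat -> nat -> nat -> tree) (i j h : nat)
    (c : nat + nat * nat) : tree :=
  match c with
  | inl e => Node Equal e (Leaf e) (T i j h.+1)
  | inr (s, h1) => Node Less s (T i s.-1 h1) (T s j (h - h1)%N)
  end.

Definition free_keys (T : nat -> nat -> nat -> tree) (i j h : nat) : seq nat :=
  [seq k <- iota i (j.+1 - i) | k \notin leaves (T i j h.+1)].

(** One least-weight free key stands for all equality candidates, because ties give equal costs. *)
Definition candidate_codes (T : nat -> nat -> nat -> tree) (i j h : nat) :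
    seq (nat + nat * nat) :=
  inl (argmin 0%N p (free_keys T i j h)) ::
  [seq inr q | q <- [seq (s, h1) | s <- iota i (j.+1 - i), h1 <- iota 0 h.+1]
             & (0 < q.1 - i - q.2)%N && (0 < j - q.1 + 1 - (h - q.2))%N].

Definition best_candidate (T : nat -> nat -> nat -> tree) (i j h : nat) : tree :=
  candidate_of T i j h
    (argmin (inl 0%N) (fun c => candidate_cost p (candidate_of T i j h c))
       (candidate_codes T i j h)).

Lemma best_candidateP m T i j h :
  run_upto m n p T -> subproblem n i j h -> (1 < j.+1 - i - h)%N ->
  (j.+1 - i - h <= m.+1)%N ->
  candidate p T i j h (best_candidate T i j h) /\
  forall c, candidate p T i j h c ->
    candidate_cost p (best_candidate T i j h) <= candidate_cost p c.
Proof.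
move=> run sub d1 dm; have [i1 jn hlt] := (subproblemE _ _ _ _).1 sub.
have memE k : (k \in free_keys T i j h) =
    (k \in itv i j) && (k \notin leaves (T i j h.+1)).
  by rewrite mem_filter mem_iota in_itv andbC; congr (_ && _); lia.
(* The no-subtree has [h.+1] fewer leaves than the interval has keys, so some key is free. *)
have free0 : free_keys T i j h != [::].
  have sub' : subproblem n i j h.+1 by apply/subproblemE; split=> //; lia.
  have /tree_forP[|S [Ssub Scard Sct]] :=
    run_tree_for _ _ _ _ _ _ _ _ run sub' ltac:(lia); first lia.
  apply/eqP => E.
  have : {subset iota i (j.+1 - i) <= leaves (T i j h.+1)}.
    move=> k kI; have : k \notin free_keys T i j h by rewrite E.
    by rewrite memE in_itv; rewrite mem_iota in kI; rewrite negb_and negbK; lia.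
  move/(uniq_leq_size (iota_uniq _ _)).
  by rewrite size_iota (size_leaves _ _ _ Sct) Scard; lia.
have [eI emin] := argminP _ _ 0%N p _ free0.
set e := argmin _ _ _ in eI emin.
rewrite memE in eI; case/andP: eI => eI eT.
pose F c := candidate_cost p (candidate_of T i j h c).
have [//|bI bmin] := argminP _ _ (inl 0%N) F (candidate_codes T i j h).
split.
  rewrite /best_candidate; move: bI; rewrite -/F; set b := argmin _ _ _.
  rewrite inE => /predU1P[->|/mapP[[s h1]]].
    by apply: EqualityCandidate => // k kI kT; apply: emin; rewrite memE kI.
  rewrite mem_filter => /andP[/andP[lo hi] /allpairsPdep[s' [h1' []]]].
  rewrite !mem_iota => sI hI [E1 E2] ->; subst s' h1'; rewrite /= in lo hi.
  by apply: LessCandidate => //; rewrite ?in_itv; lia.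
move=> c; case=> [e' eI' eT' emin'|s h1 h2 sI hE lo hi].
  have -> : candidate_cost p (Node Equal e' (Leaf e') (T i j h.+1)) = F (inl e).
    have ee : p e' = p e.
      by apply/eqP; rewrite eq_le emin' //= emin // memE eI'.
    rewrite /F /= !weight_node; congr (_ + _ + _ + _).
      by rewrite /weight /= !big_seq1.
    by rewrite /cost /= !big_seq1 ee.
  by apply: bmin; rewrite inE eqxx.
have -> : h2 = (h - h1)%N by lia.
rewrite in_itv in sI; apply: (bmin (inr (s, h1))).
rewrite inE; apply/orP; right; apply/mapP; exists (s, h1) => //.
rewrite mem_filter; apply/andP; split; first by rewrite /=; lia.
by apply/allpairsPdep; exists s, h1; rewrite !mem_iota; split=> //; lia.
Qed.

Lemma spuler_run_exists : exists T, spuler_run n p T.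
Proof.
suff [T run] : exists T, run_upto n n p T by exists T; apply/spuler_run_upto.
elim: {1}n => [|m [T run]].
  exists (fun _ _ _ => Leaf 0) => i j h /subproblemE[_ _ ?]; lia.
(* Only entries with exactly [m.+1] leaves are computed anew, from the smaller entries of [T]. A
   single leaf gets the left endpoint as its label, an arbitrary choice. *)
pose T' i j h :=
  if (j.+1 - i - h == m.+1)%N then
    if m is 0%N then Leaf i else best_candidate T i j h
  else T i j h.
have eqT i j h : (j.+1 - i - h < m.+1)%N -> T i j h = T' i j h.
  by move=> lt; rewrite /T' ifF //; lia.
exists T' => i j h sub lem; have [i1 jn hlt] := (subproblemE _ _ _ _).1 sub.
have congr1 c : (1 < j.+1 - i - h)%N ->
    candidate p T i j h c -> candidate p T' i j h c.
  by move=> d1; apply: candidate_congr => // i' j' h' lt; apply: eqT; lia.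
have congr2 c : (1 < j.+1 - i - h)%N ->
    candidate p T' i j h c -> candidate p T i j h c.
  by move=> d1; apply: candidate_congr => // i' j' h' lt; apply/esym/eqT; lia.
have [lt|eqm] : (j.+1 - i - h < m.+1)%N \/ (j.+1 - i - h = m.+1)%N by lia.
  have [leafP nodeP] := run i j h sub lt; rewrite -eqT //; split=> // d1.
  have [candT minT] := nodeP d1; split; first exact: congr1.
  by move=> c /(congr2 c d1); apply: minT.
split=> [d1|d1].
  exists i; first by rewrite in_itv; lia.
  by rewrite /T' eqm eqxx; have -> : m = 0%N by lia.
have -> : T' i j h = best_candidate T i j h.
  by rewrite /T' eqm eqxx; case: {run T' eqT congr1 congr2 lem} m eqm => //; lia.
have [candT minT] := best_candidateP m T i j h run sub d1 lem.
split; first exact: congr1.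
by move=> c /(congr2 c d1); apply: minT.
Qed.

End RunExists.

(** * Computable lower bounds on the cost of correct trees *)

Fixpoint subseqs (s : seq nat) : seq (seq nat) :=
  if s is x :: s' then subseqs s' ++ map (cons x) (subseqs s') else [:: [::]].

Lemma filter_subseqs (P : pred nat) s : filter P s \in subseqs s.
Proof.
elim: s => //= x s IH; rewrite mem_cat; case: (P x); last by rewrite IH.
by rewrite map_f // orbT.
Qed.

Section LowerBound.
Variables (n : nat) (w : nat -> nat).

(** Key sets become increasing lists, so that statements about all key sets can be decided by
    evaluation over [subseqs (iota 1 n)]. *)
Definition keys_of (S : {fset nat}) : seq nat := [seq k <- iota 1 n | k \in S].

Definition seq_weight (s : seq nat) : nat := sumn (map w s).

Lemma keys_of_filter (S : {fset nat}) (P : pred nat) :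
  keys_of [fset v in S | P v]%fset = filter P (keys_of S).
Proof.
rewrite /keys_of -filter_predI; apply: eq_filter => v.
by rewrite !inE /= andbC.
Qed.

Lemma perm_keys_of S t : {subset S <= itv 1 n} -> correct_tree n S t ->
  perm_eq (leaves t) (keys_of S).
Proof.
move=> sub [_ ut lt _]; apply: uniq_perm => //.
  exact/filter_uniq/iota_uniq.
move=> v; rewrite lt mem_filter mem_iota; apply/idP/andP => [vS|[]//].
by split=> //; move: (sub v vS); rewrite in_itv; lia.
Qed.

Lemma weightE (R : realFieldType) S t :
  {subset S <= itv 1 n} -> correct_tree n S t ->
  weight (fun k => (w k)%:R : R) t = (seq_weight (keys_of S))%:R.
Proof.
move=> sub ct; rewrite /weight (perm_big _ (perm_keys_of _ _ sub ct)) /=.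
rewrite /seq_weight; elim: (keys_of S) => [|x s IH]; first by rewrite big_nil.
by rewrite big_cons IH /= natrD.
Qed.

(* The pairs of nonempty parts into which one comparison can divide [s]. *)
Definition splits (s : seq nat) : seq (seq nat * seq nat) :=
  [seq q <- [seq (filter (outcome o k) s, filter (predC (outcome o k)) s)
            | o <- [:: Equal; Less], k <- iota 1 n]
  | (0 < size q.1)%N && (0 < size q.2)%N].

Lemma correct_tree_splits S o k y z : {subset S <= itv 1 n} ->
  correct_tree n S (Node o k y z) ->
  ([seq v <- keys_of S | outcome o k v], [seq v <- keys_of S | ~~ outcome o k v])
    \in splits (keys_of S).
Proof.
move=> sub /correct_tree_node[kn cty ctz].
have nonempty S' t : {subset S' <= itv 1 n} -> correct_tree n S' t ->
    (0 < size (keys_of S'))%N.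
  move=> sub' ct; rewrite -(perm_size (perm_keys_of _ _ sub' ct)).
  by have := search_leaves t 0; case: (leaves t).
have subS P : {subset [fset v in S | P v]%fset <= itv 1 n}.
  by move=> v vS; apply: sub; move: vS; rewrite !inE => /andP[].
rewrite mem_filter /= -!keys_of_filter.
rewrite (nonempty _ _ (subS _) cty) (nonempty _ _ (subS _) ctz).
have {}kn : k \in iota 1 n by rewrite mem_iota; rewrite in_itv in kn; lia.
rewrite !keys_of_filter cats0 mem_cat; case: o {cty ctz}.
  by rewrite (map_f (fun k => (filter (outcome Equal k) _, filter _ _)) kn).
by rewrite (map_f (fun k => (filter (outcome Less k) _, filter _ _)) kn) orbT.
Qed.

Definition cost_bound (f : seq nat -> nat) : bool :=
  all (fun k => f [:: k] == 0%N) (iota 1 n) &&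
  all (fun s => all (fun q => f s <= seq_weight s + f q.1 + f q.2)%N (splits s))
      (subseqs (iota 1 n)).

(** Induction on the tree: [cost_node] has the same shape as the inequality that [cost_bound] checks
    for the root's split, and that split is among the listed ones because every correct tree has a
    leaf. *)
Lemma cost_boundP (R : realFieldType) f S t :
  cost_bound f -> {subset S <= itv 1 n} -> correct_tree n S t ->
  (f (keys_of S))%:R <= cost (fun k => (w k)%:R : R) t.
Proof.
move=> /andP[/allP leafP /allP nodeP].
elim: t S => [k|o k y IHy z IHz] S sub ct.
  have := perm_keys_of _ _ sub ct; rewrite perm_sym => /perm_small_eq -> //=.
  rewrite /cost big_seq1 mulr0 (eqP (leafP _ _)) //.
  have : k \in itv 1 n by apply: sub; case: ct => _ _ <-; rewrite inE.
  by rewrite mem_iota in_itv; lia.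
have [kn cty ctz] := correct_tree_node _ _ _ _ _ _ ct.
have /allP/(_ _ (correct_tree_splits _ _ _ _ _ sub ct)) :=
  nodeP _ (filter_subseqs (mem S) (iota 1 n)).
have subS P : {subset [fset v in S | P v]%fset <= itv 1 n}.
  by move=> v vS; apply: sub; move: vS; rewrite !inE => /andP[].
have [_ ut _ _] := ct; rewrite cost_node // (weightE _ _ _ sub ct) /=.
rewrite -(ler_nat R) !natrD -!keys_of_filter => /le_trans; apply.
by rewrite !lerD ?IHy ?IHz.
Qed.

End LowerBound.

(** * The instance with eight keys *)

Definition key_weight (k : nat) : nat :=
  nth 0%N [:: 0; 12; 10; 4; 10; 10; 1; 11; 11]%N k.

Definition lookup (tab : seq (seq nat * nat)) (s : seq nat) : nat :=
  (nth ([::], 0%N) tab (index s (map fst tab))).2.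

(* [subseqs] lists every set after all of its subsets, so the lookups succeed;
   1000 exceeds every cost. *)
Definition min_costs : seq (seq nat * nat) :=
  Eval vm_compute in
  foldl (fun tab s => rcons tab (s,
      if (size s <= 1)%N then 0%N else
      (seq_weight key_weight s +
        foldr (fun q m => minn (lookup tab q.1 + lookup tab q.2) m)
          1000 (splits 8 s))%N))
    [::] (subseqs (iota 1 8)).

Definition min_cost (s : seq nat) : nat := lookup min_costs s.

(** The table is certified as a lower bound after it has been computed, so the fold producing it
    needs no correctness proof. Attained costs come from explicit trees. *)
Lemma min_cost_bound : cost_bound 8 key_weight min_cost.
Proof. by vm_compute. Qed.

(** A cost of at most 159 thus forces the missing key to be 1 and fixes the division at the root. *)
Lemma cost_split_159 :
  all (fun s => (size s == 7) ==>
         all (fun q =>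
           (seq_weight key_weight s + min_cost q.1 + min_cost q.2 <= 159)%N ==>
           (q == ([:: 2; 3; 4; 5; 6], [:: 7; 8])%N)) (splits 8 s))
      (subseqs (iota 1 8)).
Proof. by vm_compute. Qed.

Lemma cost_natE (R : realFieldType) (w : nat -> nat) t :
  cost (fun k => (w k)%:R : R) t =
  (sumn [seq w v * depth t v | v <- leaves t])%N%:R.
Proof.
rewrite /cost; elim: (leaves t) => [|v s IH]; first by rewrite big_nil.
by rewrite big_cons IH /= natrD natrM.
Qed.

(** A boolean checklist, which evaluation settles for explicit witness trees. *)
Lemma tree_for_computed n i j h t :
  [&& (h <= j.+1 - i)%N, size (leaves t) == (j.+1 - i - h)%N,
      all (fun v => i <= v <= j)%N (leaves t),
      all (fun k => 1 <= k <= n)%N (node_keys t), uniq (leaves t) &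
      all (fun v => search t v == v) (leaves t)] ->
  tree_for n i j h t.
Proof.
case/and5P=> leh /eqP sz /allP sub /allP keysP /andP[ut /allP searchP].
apply/tree_forP => //; exists [fset v in leaves t]%fset; split.
- by move=> v; rewrite in_fset; apply: sub.
- by rewrite card_fseq undup_id.
- split=> // [k kt|v|v]; first by rewrite in_itv keysP.
    by rewrite in_fset.
  by rewrite in_fset => /searchP/eqP.
Qed.

Theorem theorem2 (R : realFieldType) :
  exists (n : nat) (p : nat -> R),
    [/\ (forall k, k \in itv 1 n -> 0 <= p k),
        (exists T, spuler_run n p T) &
        forall T, spuler_run n p T ->
          exists i j h : nat,
            [/\ subproblem n i j h,
                tree_for n i j h (T i j h) &
                ~ min_cost_tree p n i j h (T i j h)]].
Proof.
pose p k : R := (key_weight k)%:R.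
exists 8%N, p; split=> [k _||T runT]; first exact: ler0n.
  exact: spuler_run_exists.
have run : run_upto 8 8 p T by apply/spuler_run_upto.
have sub6 : subproblem 8 1 6 1 by apply/subproblemE.
have sub8 : subproblem 8 1 8 1 by apply/subproblemE.
have tree6 : tree_for 8 1 6 1 (T 1 6 1)%N by apply: run_tree_for run sub6 _.
have tree8 : tree_for 8 1 8 1 (T 1 8 1)%N by apply: run_tree_for run sub8 _.
(* What the run stores for ([1,6], 1) depends on its choices. If it costs more than 79, that
   subproblem is already the failing one. *)
have [le79|gt79] := lerP (cost p (T 1 6 1)%N) 79%:R; last first.
  exists 1%N, 6%N, 1%N; split=> // -[_].
  (* Key 5 is the hole, and the cost is 24 + 20 + 12 + 20 + 3 = 79. *)
  pose t := Node Less 3 (Node Equal 1 (Leaf 1) (Leaf 2))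
    (Node Equal 4 (Leaf 4) (Node Equal 3 (Leaf 3) (Leaf 6))).
  move/(_ t (tree_for_computed 8 1 6 1 t isT)).
  by rewrite /p (cost_natE _ _ t) leNgt gt79.
exists 1%N, 8%N, 1%N; split=> // -[_].
(* Key 1 is the hole. The left part costs 80, the right part 22, and the total weight is 57, which
   gives 159. *)
pose t := Node Less 7
  (Node Equal 2 (Leaf 2) (Node Equal 4 (Leaf 4)
    (Node Equal 5 (Leaf 5) (Node Equal 3 (Leaf 3) (Leaf 6)))))
  (Node Equal 7 (Leaf 7) (Leaf 8)).
move/(_ t (tree_for_computed 8 1 8 1 t isT)).
rewrite {2}/p (cost_natE _ _ t) => le159.
have {}le159 : cost p (T 1 8 1)%N <= 159%:R := le159.
have [S [Sin Scard ct]] := (tree_forP 8 1 8 1 _ isT).1 tree8.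
have Ssub : {subset S <= itv 1 8} by move=> v /Sin; rewrite in_itv.
have [_ /(_ isT)[cand _]] := run 1%N 8%N 1%N sub8 isT.
(* If the stored tree cost at most 159, the lower bounds for its two subtrees would put its root
   under [cost_split_159]. *)
have splitP o k y z : (T 1 8 1)%N = Node o k y z ->
    [seq v <- keys_of 8 S | outcome o k v] = [:: 2; 3; 4; 5; 6]%N /\
    [seq v <- keys_of 8 S | ~~ outcome o k v] = [:: 7; 8]%N.
  move=> E; rewrite E in ct le159.
  have [_ cty ctz] := correct_tree_node _ _ _ _ _ _ ct.
  have /allP/(_ _ (filter_subseqs (mem S) (iota 1 8))) := cost_split_159.
  rewrite -/(keys_of 8 S) -(perm_size (perm_keys_of _ _ _ Ssub ct)).
  rewrite (size_leaves _ _ _ ct) Scard /=.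
  move/allP/(_ _ (correct_tree_splits _ _ _ _ _ _ Ssub ct)) => /implyP.
  move=> bound; apply/pair_equal_spec/eqP/bound => /=.
  have [_ ut _ _] := ct.
  rewrite -(ler_nat R) (le_trans _ le159) // cost_node //.
  rewrite (weightE _ _ _ _ _ Ssub ct).
  have Psub P : {subset [fset v in S | P v]%fset <= itv 1 8}.
    by move=> v vS; apply: Ssub; move: vS; rewrite !inE => /andP[].
  rewrite !natrD -!keys_of_filter.
  by rewrite !lerD // (cost_boundP _ _ _ _ _ _ min_cost_bound).
case E: _ / cand => [e _ _ _|s h1 h2 sI hE lo hi].
  (* An equality test sends only one key to the yes-child, yet 2 and 3 would both go there. *)
  have [/= yes _] := splitP _ _ _ _ E.
  have : 2%N \in [seq v <- keys_of 8 S | v == e] by rewrite yes.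
  have : 3%N \in [seq v <- keys_of 8 S | v == e] by rewrite yes.
  by rewrite !mem_filter => /andP[/eqP <-].
have [/= yes no] := splitP _ _ _ _ E.
(* Keys 6 and 7 lie on opposite sides of the root. *)
have s7 : s = 7%N.
  have : 6%N \in [seq v <- keys_of 8 S | (v < s)%N] by rewrite yes.
  have : 7%N \in [seq v <- keys_of 8 S | ~~ (v < s)%N] by rewrite no.
  by rewrite !mem_filter => /andP[? _] /andP[? _]; lia.
subst s; rewrite E in ct; have [_ cty _] := correct_tree_node _ _ _ _ _ _ ct.
have ysub : {subset [fset v in S | outcome Less 7 v]%fset <= itv 1 8}.
  by move=> v vS; apply: Ssub; move: vS; rewrite !inE => /andP[].
(* The left subtree is the entry [T 1 6 h1] and has five leaves out of six keys. *)
have h11 : h1 = 1%N.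
  have suby : subproblem 8 1 6 h1 by apply/subproblemE; split=> //; lia.
  have /tree_forP[|S' [_ S'card ct']] :=
    run_tree_for _ _ _ _ _ _ _ _ run suby ltac:(lia); first lia.
  have := perm_size (perm_keys_of _ _ _ ysub cty).
  by rewrite keys_of_filter yes (size_leaves _ _ _ ct') S'card /=; lia.
(* The left subtree is now both the entry for ([1,6], 1), of cost at most 79, and a tree for
   {2,3,4,5,6}, whose cost is at least 80. *)
have := cost_boundP _ _ R _ _ _ min_cost_bound ysub cty.
rewrite h11 keys_of_filter yes => /le_trans/(_ le79).
by rewrite ler_nat.
Qed.
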